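(* Given a certified $\mathsf{dec}\text{-}\mathsf{DNNF}$ $D$, one can check in polynomial time (in the size of $D$ and its clause labels) whether $D$ is correct.
   Context: A decision Decomposable Negation Normal Form circuit ($\mathsf{dec}\text{-}\mathsf{DNNF}$) $D$ on variables $X$ is a directed acyclic graph with exactly one node of indegree $0$ (the source). Nodes of outdegree $0$ (sinks) are labeled $0$ or $1$. Every other node has outdegree $2$ and is either a decision node, labeled with a variable $x\in X$, with one outgoing edge labeled $1$ and the other labeled $0$, or an $\wedge$-node. A variable $x$ is tested in $D$ if some decision node is labeled $x$; $\mathsf{var}(D)$ is the set of tested variables, and for a node $\alpha$, $D(\alpha)$ is the sub-circuit of nodes reachable from $\alpha$. It is required that every $x\in X$ is tested at most once on every source-sink path, and that every $\wedge$-node with successors $\beta,\gamma$ satisfies $\mathsf{var}(D(\beta))\cap\mathsf{var}(D(\gamma))=\emptyset$. For $\tau\in\{0,1\}^X$, a source-sink path $P$ is compatible with $\tau$ if whenever $x$ is tested on $P$, the outgoing edge labeled $\tau(x)$ is in $P$. A certified $\mathsf{dec}\text{-}\mathsf{DNNF}$ on $X$ is a $\mathsf{dec}\text{-}\mathsf{DNNF}$ on $X$ in which every $0$-sink $\alpha$ is additionally labeled with a clause $C_\alpha$ (a disjunction of literals over $X$). It is correct if for every $\tau\in\{0,1\}^X$ and every $0$-sink $\alpha$ such that some path from the source to $\alpha$ is compatible with $\tau$, we have $C_\alpha(\tau)=0$. *)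

(* Defs.v *)
From HB Require Import structures.
From mathcomp Require Import all_boot.
From Stdlib Require Import BinNums.

Set Implicit Arguments.
Unset Strict Implicit.
Unset Printing Implicit Defensive.

(** * Certified dec-DNNF circuits *)

(** The variable set X is ['I_n] and the node set is ['I_m].  [Decision x v0 v1]
    sends its 0-edge to [v0] and its 1-edge to [v1].  The two edges of a node
    may have the same head. *)
Inductive gate (n m : nat) : Type :=
| Sink of bool
| Decision of 'I_n & 'I_m & 'I_m
| Conj of 'I_m & 'I_m.
Arguments Sink {n m}.
Arguments Decision {n m}.
Arguments Conj {n m}.

Record circuit (n m : nat) : Type :=
  Circuit { source : 'I_m; gate_of : 'I_m -> gate n m }.

Section Circuit.
Variables (n m : nat) (D : circuit n m).
Implicit Types (u v : 'I_m) (x : 'I_n).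

(** The edges of [D] are the pairs [(u, b)] for which [target u b] is defined;
    at a decision node [b] is the label of the edge, at a conjunction it only
    tells the two edges apart. *)
Definition target u (b : bool) : option 'I_m :=
  match gate_of D u with
  | Sink _ => None
  | Decision _ v0 v1 => Some (if b then v1 else v0)
  | Conj v0 v1 => Some (if b then v1 else v0)
  end.

Definition arc : rel 'I_m := [rel u v | [exists b, target u b == Some v]].

Definition tests u x : bool :=
  if gate_of D u is Decision y _ _ then y == x else false.

(** [var(D(u))] *)
Definition vars u : {set 'I_n} :=
  [set x | [exists v, connect arc u v && tests v x]].

(** A path is given by its sequence of edges. *)
Fixpoint walk u (p : seq ('I_m * bool)) v : bool :=
  match p with
  | [::] => u == v
  | e :: p' =>
      (e.1 == u) && (if target e.1 e.2 is Some w then walk w p' v else false)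
  end.

(** Paths used below end in a sink, so every node tested on such a path is the
    tail of one of its edges. *)
Definition compatible (tau : {ffun 'I_n -> bool})
    (p : seq ('I_m * bool)) : Prop :=
  forall e x, e \in p -> tests e.1 x -> (e.1, tau x) \in p.

Record is_dec_dnnf : Prop := {
  acyclic : forall u v, arc u v -> ~~ connect arc v u;
  source_unique : forall v, ~~ [exists u, arc u v] = (v == source D);
  read_once : forall x p v b,
    walk (source D) p v -> gate_of D v = Sink b ->
    count (fun e => tests e.1 x) p <= 1;
  decomposable : forall u v w,
    gate_of D u = Conj v w -> vars v :&: vars w = set0
}.

End Circuit.

(** The literal [(x, true)] is x and [(x, false)] is its negation. *)
Definition clause (n : nat) : Type := seq ('I_n * bool).

Definition clause_eval n (C : clause n) (tau : {ffun 'I_n -> bool}) : bool :=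
  has (fun l => tau l.1 == l.2) C.

(** Only the values of [clause_of] at 0-sinks are meaningful. *)
Record certified_circuit (n m : nat) : Type := Certified {
  circuit_of :> circuit n m;
  clause_of : 'I_m -> clause n
}.

Definition correct n m (D : certified_circuit n m) : Prop :=
  forall (tau : {ffun 'I_n -> bool}) (a : 'I_m),
    gate_of D a = Sink false ->
    (exists2 p, walk D (source D) p a & compatible D tau p) ->
    clause_eval (clause_of D a) tau = false.

(** * Representation as words *)

Inductive token : Type :=
| TBit of bool
| TNode
| TSink of bool
| TLit of bool
| TDecision
| TConj
| TArc of bool.

Definition code_of_token (t : token) : 'I_7 * bool :=
  match t with
  | TBit b => (inord 0, b)
  | TNode => (inord 1, false)
  | TSink b => (inord 2, b)
  | TLit b => (inord 3, b)
  | TDecision => (inord 4, false)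
  | TConj => (inord 5, false)
  | TArc b => (inord 6, b)
  end.

Definition token_of_code (c : 'I_7 * bool) : option token :=
  match nat_of_ord c.1 with
  | 0 => Some (TBit c.2)
  | 1 => Some TNode
  | 2 => Some (TSink c.2)
  | 3 => Some (TLit c.2)
  | 4 => Some TDecision
  | 5 => Some TConj
  | _ => Some (TArc c.2)
  end.

Lemma code_of_tokenK : pcancel code_of_token token_of_code.
Proof. by case=> [b||b|b|||b]; rewrite /token_of_code /= inordK. Qed.

HB.instance Definition _ := Finite.copy token (pcan_type code_of_tokenK).

(** Binary digits, least significant first, without leading zeros. *)
Fixpoint bits_of_pos (p : positive) : seq bool :=
  match p with
  | xH => [:: true]
  | xO p' => false :: bits_of_pos p'
  | xI p' => true :: bits_of_pos p'
  end.

Definition enc_nat (k : nat) : seq token :=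
  map TBit (if bin_of_nat k is Npos p then bits_of_pos p else [::]).

Definition enc_literal n (l : 'I_n * bool) : seq token :=
  TLit l.2 :: enc_nat l.1.

Definition enc_gate n m (g : gate n m) (C : clause n) : seq token :=
  match g with
  | Sink true => [:: TSink true]
  | Sink false => TSink false :: flatten (map (@enc_literal n) C)
  | Decision x v0 v1 =>
      TDecision :: enc_nat x
        ++ TArc false :: enc_nat v0 ++ TArc true :: enc_nat v1
  | Conj v0 v1 =>
      TConj :: TArc false :: enc_nat v0 ++ TArc true :: enc_nat v1
  end.

(** The name of the source followed by the list of all nodes, each with its
    name and its labels. *)
Definition encode n m (D : certified_circuit n m) : seq token :=
  enc_nat (source D)
    ++ flatten [seq TNode :: enc_nat u ++ enc_gate (gate_of D u) (clause_of D u)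
               | u : 'I_m <- enum 'I_m].

(** * Deterministic multitape Turing machines *)

Inductive move : Type := MoveLeft | MoveRight | Stay.

(** [None] is the blank; the work symbols are additional to the input symbols.
    There are [extra_tapes.+1] tapes, tape [ord0] holding the input. *)
Definition cell (S W : finType) : finType := option (S + W)%type.

Record machine (S : finType) : Type := Machine {
  work : finType;
  state : finType;
  extra_tapes : nat;
  start : state;
  verdict : state -> option bool;
  delta : state -> {ffun 'I_extra_tapes.+1 -> cell S work} ->
          state * ('I_extra_tapes.+1 -> cell S work * move)
}.

(** A two-way infinite tape: [cells_right] starts with the scanned cell,
    [cells_left] with the cell to its left; all cells not listed are blank. *)
Record tape (A : Type) : Type :=
  Tape { cells_left : seq (option A); cells_right : seq (option A) }.

Definition scanned A (t : tape A) : option A := head None (cells_right t).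

Definition write_move A (t : tape A) (a : option A * move) : tape A :=
  let r := a.1 :: behead (cells_right t) in
  match a.2 with
  | MoveLeft => Tape (behead (cells_left t)) (head None (cells_left t) :: r)
  | MoveRight => Tape (a.1 :: cells_left t) (behead r)
  | Stay => Tape (cells_left t) r
  end.

Section Run.
Variables (S : finType) (M : machine S).

Definition config : Type :=
  (state M * ('I_(extra_tapes M).+1 -> tape (S + work M)))%type.

Definition init (w : seq S) : config :=
  (start M, fun i =>
     Tape [::] (if i == ord0 then [seq Some (inl s) | s <- w] else [::])).

(** A configuration whose state has a verdict is halting. *)
Definition step (c : config) : config :=
  if verdict c.1 is Some _ then c
  else let: (q, act) := delta c.1 [ffun i => scanned (c.2 i)] in
       (q, fun i => write_move (c.2 i) (act i)).

(** [M] halts on [w] after at most [t] steps with answer [b]. *)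
Definition answers_within (w : seq S) (t : nat) (b : bool) : Prop :=
  exists2 s, s <= t & verdict (iter s step (init w)).1 = Some b.

End Run.

(* Main.v *)
From HB Require Import structures.
Require Import Defs.
From mathcomp Require Import all_boot all_order all_algebra.
From mathcomp Require Import zify.
From Stdlib Require Import BinNums.

Set Implicit Arguments.
Unset Strict Implicit.
Unset Printing Implicit Defensive.

(** Every path to a sink tests a variable at most once, so it is compatible with
    some assignment, and the value of a variable that it does not test is free.
    Hence [D] is incorrect iff there are a 0-sink [a] and a literal [(x, b)] of
    its clause such that [a] is reachable from the source without using an edge
    that sets [x] to [~~ b].

    The machine runs one such search per literal.  It keeps a list of visited
    names and repeatedly scans the whole circuit, appending the permitted
    successors of each node whose name is in the list.  Names may be appended
    several times: as the number of scans is the length of the input, the list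
    stays of quadratic length without any test for duplicates. *)

(** * Composing machines *)

(** The answer must come from an actual Turing machine with an explicit time bound. Programs are
    therefore assembled from one-step machines by [bind] and [loop], and [runs] records for each of
    them the exit, the final tapes and a time bound. Loops need no general invariant rule: each is
    unrolled by induction on the word or list that it scans.

    Let n be the length of the input. n scans suffice because each node occupies at least one token
    and a simple path meets each node at most once. A scan lengthens the list by at most n, since
    every appended name with its terminator is matched by an arc token and the name after it in the
    input. So all work tapes stay below P = (n + 3)^2. In a scan one token costs O(P^2), because of
    the membership test; a scan costs O(P^3), a search O(P^4) and all searches O(P^5), which gives
    the exponent 10. *)

Section Programs.
Variables (S : finType) (k : nat).

Notation symbol := (option S).
Notation tp := (tape (S + void)).
Notation tapes := ('I_k.+1 -> tp).

Definition to_cell (c : symbol) : cell S void := omap inl c.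

Definition of_cell (c : cell S void) : symbol :=
  if c is Some (inl s) then Some s else None.

Definition reads (T : tapes) : {ffun 'I_k.+1 -> cell S void} :=
  [ffun i => scanned (T i)].

Definition apply (a : 'I_k.+1 -> cell S void * move) (T : tapes) : tapes :=
  fun i => write_move (T i) (a i).

(** A machine with one exit for each element of [L]. *)
Record prog (L : Type) : Type := Prog {
  pstate : finType;
  pstart : pstate;
  pdelta : pstate -> {ffun 'I_k.+1 -> cell S void} ->
           (pstate + L) * ('I_k.+1 -> cell S void * move)
}.

Inductive exec (Q L : Type)
    (d : Q -> {ffun 'I_k.+1 -> cell S void} ->
         (Q + L) * ('I_k.+1 -> cell S void * move)) :
    Q -> tapes -> nat -> L -> tapes -> Prop :=
| ExecExit q T l a :
    d q (reads T) = (inr l, a) -> exec d q T 1 l (apply a T)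
| ExecStep q T q' a t l T' :
    d q (reads T) = (inl q', a) ->
    exec d q' (apply a T) t l T' -> exec d q T t.+1 l T'.

Definition machine_of (p : prog bool) : machine S :=
  @Machine S void (pstate p + bool)%type k (inl (pstart p))
    (fun q => if q is inr b then Some b else None)
    (fun q r => match q with
                | inl q => pdelta q r
                | inr b => (inr b, fun i => (r i, Stay))
                end).

Lemma exec_machine_of (p : prog bool) q T t b T' :
  exec (@pdelta _ p) q T t b T' ->
  iter t (@step S (machine_of p)) (inl q, T) = (inr b, T').
Proof.
elim=> {q T t b T'} [q T l a E|q T q' a t l T' E _ IH].
  by rewrite /= /step /= E.
by rewrite iterSr {2}/step /= E.
Qed.

(** Equality of tapes up to explicit trailing blanks. *)
Definition teq (t t' : tp) : Prop :=
  (forall j, nth None (cells_left t) j = nth None (cells_left t') j) /\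
  (forall j, nth None (cells_right t) j = nth None (cells_right t') j).

Lemma teq_refl t : teq t t. Proof. by []. Qed.

Lemma teq_sym t t' : teq t t' -> teq t' t.
Proof. by case=> h1 h2; split=> j; rewrite (h1, h2). Qed.

Lemma teq_trans t2 t1 t3 : teq t1 t2 -> teq t2 t3 -> teq t1 t3.
Proof. by case=> h1 h2 [h3 h4]; split=> j; rewrite (h1, h2) (h3, h4). Qed.

Lemma teq_scanned t t' : teq t t' -> scanned t = scanned t'.
Proof. by case=> _ /(_ 0); rewrite !nth0. Qed.

Lemma teq_write_move t t' a :
  teq t t' -> teq (write_move t a) (write_move t' a).
Proof.
case: t t' a => [l r] [l' r'] [c mv] [/= hl hr].
have hb (s s' : seq (cell S void)) : (forall j, nth None s j = nth None s' j) ->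
  forall j, nth None (behead s) j = nth None (behead s') j.
  by move=> h j; rewrite !nth_behead.
have hh : head None l = head None l' by have := hl 0; rewrite !nth0.
have hc (a : cell S void) s s' : (forall j, nth None s j = nth None s' j) ->
  forall j, nth None (a :: s) j = nth None (a :: s') j by move=> h [|j] /=.
by case: mv; split=> /=; rewrite ?hh; auto.
Qed.

(** A machine sees only scanned cells, and these agree on [teq] tapes. This is what allows
    specifications that give tapes only up to [teq] to be chained. *)
Lemma exec_teq Q L d (q : Q) T t (l : L) T1 : exec d q T t l T1 ->
  forall T', (forall i, teq (T i) (T' i)) ->
  exists2 T1', (forall i, teq (T1 i) (T1' i)) & exec d q T' t l T1'.
Proof.
have reads_teq T0 T0' : (forall i, teq (T0 i) (T0' i)) -> reads T0' = reads T0.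
  by move=> h; apply/ffunP => i; rewrite !ffunE (teq_scanned (h i)).
have apply_teq a T0 T0' : (forall i, teq (T0 i) (T0' i)) ->
    forall i, teq (apply a T0 i) (apply a T0' i).
  by move=> h i; apply: teq_write_move.
elim=> {q T t l T1} [q T l a E|q T q' a t l T1 E _ IH] T' h.
  by exists (apply a T'); [exact: apply_teq|apply: ExecExit;
    rewrite (reads_teq T)].
have [T1' h1 h2] := IH _ (apply_teq a _ _ h).
by exists T1' => //; apply: ExecStep h2; rewrite (reads_teq T).
Qed.

Definition blank : tp := Tape [::] [::].

Definition layout (T : seq tp) : tapes := fun i => nth blank T i.

(** The time is only a bound and the final tapes are given only up to [teq], so specifications can
    be weakened freely. Tapes form a list rather than a function, so that updates are [set_nth] and
    configurations can be written out literally. *)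
Definition runs L (p : prog L) (T : seq tp) (t : nat) (l : L) (T' : seq tp) :
    Prop :=
  exists s T1, [/\ s <= t, forall i, teq (T1 i) (layout T' i)
                 & exec (@pdelta _ p) (pstart p) (layout T) s l T1].

Lemma runs_le L (p : prog L) T t t' l T' :
  t <= t' -> runs p T t l T' -> runs p T t' l T'.
Proof. by move=> h [s [T1 [hs ? ?]]]; exists s, T1; split=> //; lia. Qed.

Definition seq_teq (T T' : seq tp) :=
  forall i, teq (nth blank T i) (nth blank T' i).

Lemma runs_teqr L (p : prog L) T t l T' T2 :
  seq_teq T' T2 -> runs p T t l T' -> runs p T t l T2.
Proof.
move=> h [s [T1 [hs h1 h2]]]; exists s, T1; split=> // i.
exact: teq_trans (h1 i) (h i).
Qed.

Lemma runs_teql L (p : prog L) T t l T' T2 :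
  seq_teq T2 T -> runs p T2 t l T' -> runs p T t l T'.
Proof.
move=> h [s [T1 [hs h1 h2]]].
have [T1' h3 h4] := exec_teq h2 (fun i => h i).
exists s, T1'; split=> // i; apply: teq_trans (h1 i); exact: teq_sym.
Qed.

Section Bind.
Variables (L : finType) (L' : Type) (p : prog L) (f : L -> prog L').

(** The exiting transition of [p] is redirected to the start of [f l], so composition costs no extra
    step. The exit values index the state space, hence [L] is a [finType]. *)
Definition bind : prog L' :=
  @Prog L' (pstate p + {l : L & pstate (f l)})%type (inl (pstart p))
    (fun q r => match q with
     | inl q => let: (o, a) := pdelta q r in
         (inl (match o with
               | inl q' => inl q'
               | inr l => inr (Tagged (fun l => pstate (f l)) (pstart (f l)))
               end), a)
     | inr q => let: (o, a) := pdelta (tagged q) r in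
         (match o with
          | inl q' => inl (inr (Tagged (fun l => pstate (f l)) q'))
          | inr l' => inr l'
          end, a)
     end).

Lemma runs_bind T t l T1 t' l' T2 :
  runs p T t l T1 -> runs (f l) T1 t' l' T2 -> runs bind T (t + t') l' T2.
Proof.
case=> s [U [hs hU e1]] [s' [U' [hs' hU' e2]]].
have [U2 h3 e3] := exec_teq e2 (fun i => teq_sym (hU i)).
exists (s + s'), U2; split; first lia.
  by move=> i; apply: teq_trans (hU' i); apply: teq_sym.
have e4 : exec (@pdelta _ bind) (inr 
    (Tagged (fun l => pstate (f l)) (pstart (f l)))) U s' l' U2.
  elim: e3 => {e2 h3} [q V l1 a E|q V q' a n l1 V' E _ IH].
    by apply: ExecExit; rewrite /= E.
  by apply: ExecStep IH; rewrite /= E.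
rewrite -[pstart bind]/(inl (pstart p));
  elim: e1 e4 => {hs hU e2 e3} [q V l1 a E|q V q' a n l1 V' E _ IH] e4.
  by apply: ExecStep e4; rewrite /= E.
by apply: ExecStep (IH e4); rewrite /= E.
Qed.

End Bind.

Section Loop.
Variables (A : finType) (L : Type) (body : A -> prog (A + L)).

(** A value of [A] is the finite memory carried from one round to the next; it is kept in the state,
    not on a tape. *)
Definition loop (x : A) : prog L :=
  @Prog L {x : A & pstate (body x)}
    (Tagged (fun x => pstate (body x)) (pstart (body x)))
    (fun q r => let: (o, a) := pdelta (tagged q) r in
       (match o with
        | inl q' => inl (Tagged (fun x => pstate (body x)) q')
        | inr (inl y) =>
            inl (Tagged (fun x => pstate (body x)) (pstart (body y)))
        | inr (inr l) => inr l
        end, a)).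

(** Both kinds of exit are treated in one statement because the induction runs over a round whose
    exit is not yet known. For a restart, the round is prepended to an arbitrary execution of the
    next ones. *)
Lemma exec_loop x q T t o T1 :
  exec (@pdelta _ (body x)) q T t o T1 ->
  let q' := Tagged (fun x => pstate (body x)) q in
  match o with
  | inl y => forall t' l T2,
      exec (@pdelta _ (loop y)) (pstart (loop y)) T1 t' l T2 ->
      exec (@pdelta _ (loop x)) q' T (t + t') l T2
  | inr l => exec (@pdelta _ (loop x)) q' T t l T1
  end.
Proof.
elim=> {q T t o T1} [q T o a E|q T q' a t o T1 E _ IH] /=.
  case: o E => [y E t' l T2 e|l E]; last by apply: ExecExit; rewrite /= E.
  by rewrite add1n; apply: ExecStep e; rewrite /= E.
case: o IH => [y IH t' l T2 e|l IH]; last by apply: ExecStep IH; rewrite /= E.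
by rewrite addSn; apply: ExecStep (IH _ _ _ e); rewrite /= E.
Qed.

Lemma runs_loop_exit x T t l T1 :
  runs (body x) T t (inr l) T1 -> runs (loop x) T t l T1.
Proof. by case=> s [U [hs hU /exec_loop e]]; exists s, U. Qed.

Lemma runs_loop_next x y T t T1 t' l T2 :
  runs (body x) T t (inl y) T1 -> runs (loop y) T1 t' l T2 ->
  runs (loop x) T (t + t') l T2.
Proof.
case=> s [U [hs hU e1]] [s' [U' [hs' hU' e2]]].
have [U2 h3 e3] := exec_teq e2 (fun i => teq_sym (hU i)).
exists (s + s'), U2; split; first lia.
  by move=> i; apply: teq_trans (hU' i); apply: teq_sym.
exact: (exec_loop e1).
Qed.

End Loop.

Definition on L (i : nat) (g : symbol -> (symbol * move) * L) : prog L :=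
  @Prog L unit tt (fun _ r =>
    let a := g (of_cell (r (inord i))) in
    (inr a.2, fun j : 'I_k.+1 =>
       if (j : nat) == i then (to_cell a.1.1, a.1.2) else (r j, Stay))).

Definition tread (T : seq tp) i := of_cell (scanned (nth blank T i)).

Definition twrite (T : seq tp) i (a : symbol * move) :=
  set_nth blank T i (write_move (nth blank T i) (to_cell a.1, a.2)).

(** Not an equality: writing back the blank beyond the listed cells makes it explicit. *)
Lemma teq_stay (t : tp) : teq (write_move t (scanned t, Stay)) t.
Proof. by case: t => l [|c r]; split=> //= -[|[|j]]. Qed.

Lemma runs_on L i (g : symbol -> (symbol * move) * L) T : i <= k ->
  runs (on i g) T 1 (g (tread T i)).2 (twrite T i (g (tread T i)).1).
Proof.
move=> hi; have hr : of_cell (reads (layout T) (inord i)) = tread T i.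
  by rewrite ffunE /layout inordK.
eexists 1, _; split; [by [] | | by apply: ExecExit; rewrite /= hr].
move=> j; rewrite /apply /layout /twrite /= nth_set_nth /= ffunE.
case: eqP => [->|_]; first by split.
exact: teq_stay.
Qed.

Definition on2 L (i j : nat)
    (g : symbol -> symbol -> ((symbol * move) * (symbol * move)) * L) :
    prog L :=
  @Prog L unit tt (fun _ r =>
    let a := g (of_cell (r (inord i))) (of_cell (r (inord j))) in
    (inr a.2, fun h : 'I_k.+1 =>
       if (h : nat) == i then (to_cell a.1.1.1, a.1.1.2)
       else if (h : nat) == j then (to_cell a.1.2.1, a.1.2.2)
       else (r h, Stay))).

Lemma runs_on2 L i j
    (g : symbol -> symbol -> ((symbol * move) * (symbol * move)) * L) T :
  i <= k -> j <= k -> i != j ->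
  let a := g (tread T i) (tread T j) in
  runs (on2 i j g) T 1 a.2 (twrite (twrite T i a.1.1) j a.1.2).
Proof.
move=> hi hj hij /=.
have hr h : h <= k -> of_cell (reads (layout T) (inord h)) = tread T h.
  by move=> hh; rewrite ffunE /layout inordK.
eexists 1, _; split; [by [] | | by apply: ExecExit; rewrite /= !hr].
move=> h; rewrite /apply /layout /twrite /= !nth_set_nth /= ffunE.
rewrite nth_set_nth /= [j == i]eq_sym (negbTE hij).
case: (eqVneq (h : nat) i) => [->|hi']; last first.
  by case: (eqVneq (h : nat) j) => [->|hj']; [split|exact: teq_stay].
by rewrite (negbTE hij); split.
Qed.

(** Exiting takes a transition, so even returning a value costs one step. *)
Definition ret L (l : L) : prog L := on 0 (fun c => ((c, Stay), l)).

End Programs.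

(** * Scanning, copying, rewinding and erasing words on tapes *)

Section Routines.
Variables (S : finType) (k : nat).

Notation symbol := (option S).
Notation tp := (tape (S + void)).
Notation blank := (@blank S).
Notation prog := (prog S k).

(** The word [rev l ++ r], the head scanning the first symbol of [r]. *)
Definition ztape (l r : seq S) : tp :=
  Tape [seq Some (inl s) | s <- l] [seq Some (inl s) | s <- r].

Lemma scanned_ztape l r : of_cell (scanned (ztape l r)) = ohead r.
Proof. by case: r. Qed.

Lemma teq_set_nth T i (t t' : tp) :
  teq t t' -> seq_teq (set_nth blank T i t) (set_nth blank T i t').
Proof.
by move=> h j; rewrite !nth_set_nth /=; case: eqP => _ //; apply: teq_refl.
Qed.

Lemma teq_set_nth_id T i (t : tp) :
  teq t (nth blank T i) -> seq_teq (set_nth blank T i t) T.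
Proof.
by move=> h j; rewrite !nth_set_nth /=; case: eqP => [->|_] //; apply: teq_refl.
Qed.

Lemma runs_on_ztape L i (g : symbol -> (symbol * move) * L) T l r t c mv x :
  i <= k -> nth blank T i = ztape l r -> g (ohead r) = ((c, mv), x) ->
  teq (write_move (ztape l r) (to_cell c, mv)) t ->
  runs (on k i g) T 1 x (set_nth blank T i t).
Proof.
move=> hi hT hg ht; have := runs_on g T hi.
rewrite /twrite /tread hT scanned_ztape hg; apply: runs_teqr;
  exact: teq_set_nth.
Qed.

Lemma runs_on2_ztape L i j
    (g : symbol -> symbol -> ((symbol * move) * (symbol * move)) * L)
    T l r t l' r' t' c mv c' mv' x :
  i <= k -> j <= k -> i != j ->
  nth blank T i = ztape l r -> nth blank T j = ztape l' r' ->
  g (ohead r) (ohead r') = (((c, mv), (c', mv')), x) ->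
  teq (write_move (ztape l r) (to_cell c, mv)) t ->
  teq (write_move (ztape l' r') (to_cell c', mv')) t' ->
  runs (on2 k i j g) T 1 x (set_nth blank (set_nth blank T i t) j t').
Proof.
move=> hi hj hij hT hT' hg ht ht'; have := runs_on2 g T hi hj hij.
rewrite /twrite /tread hT hT' !scanned_ztape hg; apply: runs_teqr => h.
rewrite !nth_set_nth /= !nth_set_nth /= [j == i]eq_sym (negbTE hij) hT'.
by case: eqP => _ //; case: eqP => _ //; apply: teq_refl.
Qed.

Lemma ztape_stay l r :
  teq (write_move (ztape l r) (to_cell (ohead r), Stay)) (ztape l r).
Proof. by case: r => [|s r]; split=> //= -[|[|j]]. Qed.

Lemma ztape_left s l r :
  teq (write_move (ztape (s :: l) r) (to_cell (ohead r), MoveLeft))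
    (ztape l (s :: r)).
Proof. by case: r => [|s' r]; split=> //= -[|[|[|j]]]. Qed.

Lemma ztape_left_right r :
  let t := write_move (ztape [::] r) (to_cell (ohead r), MoveLeft) in
  scanned t = None /\ teq (write_move t (None, MoveRight)) (ztape [::] r).
Proof. by case: r => [|s' r]; split=> //; split=> -[|[|j]]. Qed.

Lemma runs_ret L (x : L) T : runs (ret S k x) T 1 x T.
Proof.
apply: runs_teqr (runs_on _ _ (leq0n k)) => i; rewrite nth_set_nth /=.
case: eqP => [->|_]; last exact: teq_refl.
rewrite /tread /=; case: (nth _ _ _) => l [|[[s|[]]|] r]; split=> // -[|j] //.
by case: j.
Qed.

Definition skip (P : pred S) i : prog unit :=
  loop (fun _ : unit => on k i (fun c =>
    if c is Some s then
      if P s then ((c, MoveRight), inl tt) else ((c, Stay), inr tt)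
    else ((c, Stay), inr tt))) tt.

(** Makes the part before [r] a maximal block of [P]-symbols, so that a scan ends exactly at [r];
    the blank after the word also ends it. *)
Definition stops (P : pred S) (r : seq S) :=
  if r is s :: _ then ~~ P s else true.

Lemma set_nth2 (T : seq tp) i t t' :
  set_nth blank (set_nth blank T i t) i t' = set_nth blank T i t'.
Proof. by rewrite set_set_nth eqxx. Qed.

Lemma runs_skip P i T l r1 r2 : i <= k -> all P r1 -> stops P r2 ->
  nth blank T i = ztape l (r1 ++ r2) ->
  runs (skip P i) T (size r1).+1 tt
    (set_nth blank T i (ztape (catrev r1 l) r2)).
Proof.
move=> hi; elim: r1 => [|s r1 IH] /= in T l * => [_ h2 hT|/andP[hs h1] h2 hT].
  apply/runs_loop_exit/(runs_on_ztape hi hT _ (ztape_stay l r2)).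
  by case: r2 h2 {hT} => //= s r2 /negbTE->.
rewrite -add1n; apply: (runs_loop_next (runs_on_ztape hi hT _ (teq_refl _))).
  by rewrite /= hs.
have := IH (set_nth blank T i (ztape (s :: l) (r1 ++ r2))) (s :: l) h1 h2.
by rewrite set_nth2; apply; rewrite nth_set_nth /= eqxx.
Qed.

Definition copy (P : pred S) i j : prog unit :=
  loop (fun _ : unit => on2 k i j (fun c c' =>
    if c is Some s then
      if P s then (((c, MoveRight), (c, MoveRight)), inl tt)
      else (((c, Stay), (c', Stay)), inr tt)
    else (((c, Stay), (c', Stay)), inr tt))) tt.

Lemma runs_copy P i j T l r1 r2 l' :
  i <= k -> j <= k -> i != j -> all P r1 -> stops P r2 ->
  nth blank T i = ztape l (r1 ++ r2) -> nth blank T j = ztape l' [::] ->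
  runs (copy P i j) T (size r1).+1 tt
    (set_nth blank (set_nth blank T i (ztape (catrev r1 l) r2))
       j (ztape (catrev r1 l') [::])).
Proof.
move=> hi hj hij.
elim: r1 => [|s r1 IH] /= in T l l' * => [_ h2 hT hT'|/andP[hs h1] h2 hT hT'].
  apply/runs_loop_exit/(runs_on2_ztape hi hj hij hT hT' _ (ztape_stay l r2)
    (ztape_stay l' [::])).
  by case: r2 h2 {hT} => //= s r2 /negbTE->.
rewrite -add1n; apply: (runs_loop_next (runs_on2_ztape hi hj hij hT hT' _
  (teq_refl _) (teq_refl _))).
  by rewrite /= hs.
have := IH (set_nth blank (set_nth blank T i (ztape (s :: l) (r1 ++ r2)))
  j (ztape (s :: l') [::])) (s :: l) (s :: l') h1 h2.
rewrite !nth_set_nth /= !nth_set_nth /= !eqxx (negbTE hij) => /(_ erefl erefl).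
apply: runs_teqr => h; rewrite !nth_set_nth /= !nth_set_nth /= !nth_set_nth /=
  !nth_set_nth /=.
by case: eqP => _ //; case: eqP => _ //; apply: teq_refl.
Qed.

(** The first move is unconditional, since the head may already stand on the blank behind the
    word. *)
Definition rewind i : prog unit :=
  bind (on k i (fun c => ((c, MoveLeft), tt))) (fun _ : unit =>
  loop (fun _ : unit => on k i (fun c =>
    if c is Some _ then ((c, MoveLeft), inl tt) else ((c, MoveRight),
      inr tt))) tt).

Lemma runs_rewind i T l r : i <= k -> nth blank T i = ztape l r ->
  runs (rewind i) T (size l).+2 tt (set_nth blank T i (ztape [::] (catrev l
    r))).
Proof.
move=> hi hT; rewrite -[(size l).+2]add1n.
apply: (runs_bind (runs_on_ztape hi hT erefl (teq_refl _))).
(* The induction is over tapes just obtained by a left move from [ztape l r]; for empty [l] the head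
   is then left of the word and the tape is no [ztape]. *)
set t := write_move _ _; rewrite -(set_nth2 T i t (ztape _ _)).
have: nth blank (set_nth blank T i t) i = t by rewrite nth_set_nth /= eqxx.
rewrite {}/t; move: (set_nth _ _ _ _) => {hT} {}T.
elim: l => [|s l IH] in T r * => hT.
  apply: runs_loop_exit.
  have [h1 h2] := ztape_left_right r.
  have := @runs_on S k _ i (fun c => if c is Some _ then ((c, MoveLeft), inl tt)
    else ((c, MoveRight), inr tt : unit + unit)) T hi.
  rewrite /twrite /tread hT h1; apply: runs_teqr; exact: teq_set_nth.
apply: (runs_teql (T2 := set_nth blank T i (ztape l (s :: r)))).
  by apply: teq_set_nth_id; rewrite hT; apply/teq_sym/ztape_left.
have hT' : nth blank (set_nth blank T i (ztape l (s :: r)))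
  i = ztape l (s :: r).
  by rewrite nth_set_nth /= eqxx.
rewrite -add1n; apply: (runs_loop_next (runs_on_ztape hi hT' erefl (teq_refl
  _))).
set t := write_move _ _; have := IH (set_nth blank T i t) (s :: r).
by rewrite !set_nth2; apply; rewrite nth_set_nth /= eqxx.
Qed.

Definition erase i : prog unit :=
  bind (rewind i) (fun _ : unit =>
  loop (fun _ : unit => on k i (fun c =>
    if c is Some _ then ((None, MoveRight), inl tt)
    else ((c, Stay), inr tt))) tt).

Lemma runs_erase i T l r : i <= k -> nth blank T i = ztape l r ->
  runs (erase i) T ((size l).+2 + (size l + size r).+1) tt
    (set_nth blank T i (ztape [::] [::])).
Proof.
move=> hi hT; apply: (runs_bind (runs_rewind hi hT)).
set t := ztape _ _; rewrite -(set_nth2 T i t (ztape [::] [::])).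
have: nth blank (set_nth blank T i t) i = t by rewrite nth_set_nth /= eqxx.
have -> : size l + size r = size (catrev l r)
  by rewrite catrevE size_cat size_rev.
rewrite {}/t; move: (catrev l r) => w; move: (set_nth _ _ _ _) => {hT} {}T.
elim: w => [|s w IH] in T * => hT.
  by apply/runs_loop_exit/(runs_on_ztape hi hT _ (ztape_stay _ _)).
rewrite -[(size _).+1]add1n.
(* The erased cell becomes a blank on the left, which [teq] does not distinguish from an empty left
   part. *)
apply: (runs_loop_next (T1 := set_nth blank T i (ztape [::] w))).
  by apply: (runs_on_ztape hi hT erefl) => /=; split=> // -[|[|j]].
rewrite -(set_nth2 T i (ztape [::] w) (ztape [::] [::])); apply: IH.
by rewrite nth_set_nth /= eqxx.
Qed.

Lemma size_le_catrev (l r : seq S) : size l <= size (catrev l r).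
Proof. by rewrite catrevE size_cat size_rev leq_addr. Qed.

End Routines.

(** * Operations on names *)

Definition is_bit (t : token) : bool := if t is TBit _ then true else false.

Notation word := (map TBit).

Lemma all_is_bit (u : seq bool) : all is_bit (word u).
Proof. by elim: u. Qed.

Lemma catrevK (T : Type) (s : seq T) : catrev (catrev s [::]) [::] = s.
Proof. exact: revK. Qed.

Lemma catrev_catrev (T : Type) (s l r : seq T) :
  catrev (catrev s l) r = catrev l (s ++ r).
Proof. by elim: s l => //= x s IH l; rewrite IH. Qed.

(** The head rests behind the word, where the next symbol is appended. *)
Notation ntape l := (ztape (catrev l [::]) [::]).

Section Names.
Variable k : nat.

Notation tp := (tape (token + void)).
Notation blank := (@blank token).
Notation prog := (prog token k).
Implicit Types (T : seq tp) (u v : seq bool) (l r : seq token).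

Definition match_bits i j : prog bool :=
  loop (fun _ : unit => on2 k i j (fun c c' =>
    match c, c' with
    | Some (TBit a), Some (TBit b) =>
        if a == b then (((c, MoveRight), (c', MoveRight)), inl tt)
        else (((c, Stay), (c', Stay)), inr false)
    | None, Some (TBit _) => (((c, Stay), (c', Stay)), inr false)
    | None, _ => (((c, Stay), (c', Stay)), inr true)
    | _, _ => (((c, Stay), (c', Stay)), inr false)
    end)) tt.

(** The heads stop at the first difference; the splittings of [u] and [v] record where, so that the
    caller can bring both heads to a known place. *)
Lemma runs_match_bits i j T l l' u v r :
  i <= k -> j <= k -> i != j -> stops is_bit r ->
  nth blank T i = ztape l (word u) -> nth blank T j = ztape l' (word v ++ r) ->
  exists u1 u2 v1 v2, [/\ u = u1 ++ u2, v = v1 ++ v2 &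
    runs (match_bits i j) T (size u).+1 (u == v)
      (set_nth blank (set_nth blank T i (ztape (catrev (word u1) l) (word u2)))
         j (ztape (catrev (word v1) l') (word v2 ++ r)))].
Proof.
move=> hi hj hij hr; elim: u v => [|a u IH] v in T l l' * => hT hT'.
  exists [::], [::], [::], v; split=> //.
  apply/runs_loop_exit/(runs_on2_ztape hi hj hij hT hT' _ (ztape_stay _ _)
    (ztape_stay _ _)).
  by case: v {hT'} => //=; case: r hr => //= -[].
case: v hT' => [|b v] hT'.
  exists [::], (a :: u), [::], [::]; split=> //.
  apply/(runs_le (t := 1)) => //.
  apply/runs_loop_exit/(runs_on2_ztape hi hj hij hT hT' _ (ztape_stay _ _)
    (ztape_stay _ _)).
  by case: r hr {IH hT'} => //= -[].
have [eab|nab] := eqVneq b a; last first.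
  exists [::], (a :: u), [::], (b :: v); split=> //.
  apply/(runs_le (t := 1)) => //.
  apply/runs_loop_exit/(runs_on2_ztape hi hj hij hT hT' _ (ztape_stay _ _)
    (ztape_stay _ _)).
  by rewrite /= eqseq_cons [a == b]eq_sym (negbTE nab).
subst b.
set T1 := set_nth blank (set_nth blank T i (ztape (TBit a :: l) (word u))) j
  (ztape (TBit a :: l') (word v ++ r)).
have [||u1 [u2 [v1 [v2 [-> -> h]]]]] := IH v T1 (TBit a :: l) (TBit a :: l').
- by rewrite !nth_set_nth /= !nth_set_nth /= (negbTE hij) eqxx.
- by rewrite !nth_set_nth /= !nth_set_nth /= eqxx.
exists (a :: u1), u2, (a :: v1), v2; split=> //.
rewrite -add1n; apply: (runs_loop_next (runs_on2_ztape hi hj hij hT hT' _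
  (teq_refl _) (teq_refl _))).
  by rewrite /= eqxx.
rewrite eqseq_cons eqxx /=; apply: runs_teqr h => h.
rewrite !nth_set_nth /= !nth_set_nth /= !nth_set_nth /= !nth_set_nth /=.
by case: eqP => _ //; case: eqP => _ //; apply: teq_refl.
Qed.

(** Whatever the outcome, the head on [i] returns to the start and the one on [j] ends behind the
    name, so the caller need not know where the names differ. *)
Definition compare i j : prog bool :=
  bind (match_bits i j) (fun e =>
  bind (rewind token k i) (fun _ =>
  bind (skip k is_bit j) (fun _ => ret token k e))).

Lemma runs_compare i j T l u v r :
  i <= k -> j <= k -> i != j -> stops is_bit r ->
  nth blank T i = ztape [::] (word u) ->
  nth blank T j = ztape l (word v ++ r) ->
  runs (compare i j) T (2 * size u + size v + 5) (u == v)
    (set_nth blank T j (ztape (catrev (word v) l) r)).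
Proof.
move=> hi hj hij hr hT hT'.
have [u1 [u2 [v1 [v2 [Eu Ev h]]]]] := runs_match_bits hi hj hij hr hT hT'.
apply: runs_le; last first.
  apply: runs_teqr; last first.
    apply: (runs_bind h).
    apply: runs_bind; first apply: runs_rewind => //.
      by rewrite nth_set_nth /= nth_set_nth /= (negbTE hij) eqxx.
    apply: runs_bind; last exact: runs_ret.
    apply: (runs_skip hj (all_is_bit v2) hr).
    by rewrite nth_set_nth /= [j == i]eq_sym (negbTE hij) nth_set_nth /= eqxx.
  move=> h'; rewrite !nth_set_nth /= !nth_set_nth /= !nth_set_nth /=
    !nth_set_nth /=.
  case: eqP => [_|_]; first by rewrite Ev map_cat catrev_catl; apply: teq_refl.
  case: eqP => [->|_]; last exact: teq_refl.
  by rewrite hT Eu map_cat !catrevE !cats0 revK; apply: teq_refl.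
rewrite Eu Ev !size_cat !size_map catrevE size_cat size_rev size_map /=; lia.
Qed.

(** Names need a terminator: they have varying length, and the name of node 0 is the empty word. *)
Definition names_word (N : seq (seq bool)) : seq token :=
  flatten [seq word n ++ [:: TNode] | n <- N].

(** The final [skip] brings the head back to the end of the list, so the test leaves the tapes as
    they were and the list is ready for appending. *)
Definition member i j : prog bool :=
  bind (rewind token k j) (fun _ =>
  bind (loop (fun _ : unit =>
    bind (on k j (fun c => ((c, Stay), c != None))) (fun b : bool =>
    if b then bind (compare i j) (fun e =>
      on k j (fun c => ((c, MoveRight), if e then inr true else inl tt)))
    else ret token k (inr false))) tt) (fun f : bool =>
  bind (skip k predT j) (fun _ => ret token k f))).

Lemma runs_member i j T u N :
  i <= k -> j <= k -> i != j ->
  nth blank T i = ztape [::] (word u) -> nth blank T j = ntape (names_word N) ->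
  runs (member i j) T ((2 * size u + 11) * (size (names_word N)).+2)
    (u \in N) T.
Proof.
move=> hi hj hij hT hT'.
pose T1 l r := set_nth blank T j (ztape l r).
have hTi l r : nth blank (T1 l r) i = ztape [::] (word u).
  by rewrite nth_set_nth /= (negbTE hij).
have hTj l r : nth blank (T1 l r) j = ztape l r by rewrite nth_set_nth /= eqxx.
(* A successful search stops inside the list, so only the contents [catrev l1 r1] are tracked and
   not the position of the head. *)
suff main l : exists l1 r1, catrev l1 r1 = catrev l (names_word N) /\
  runs (loop (fun _ : unit =>
    bind (on k j (fun c => ((c, Stay), c != None))) (fun b : bool =>
    if b then bind (compare i j) (fun e =>
      on k j (fun c => ((c, MoveRight), if e then inr true else inl tt)))
    else ret token k (inr false))) tt) (T1 l (names_word N))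
    ((2 * size u + 8) * (size (names_word N)).+1) (u \in N) (T1 l1 r1).
  have [l1 [r1 [E h]]] := main [::].
  apply: runs_le; last first.
    apply: runs_teqr; last first.
      apply: runs_bind.
        apply: runs_rewind hj hT'.
      rewrite catrevK.
      apply: (runs_bind h).
      apply: runs_bind; last exact: runs_ret.
      apply: (@runs_skip _ _ predT _ _ l1 r1 [::] hj) => //;
        first exact: all_predT.
      by rewrite hTj cats0.
    move=> h'; rewrite /T1 !nth_set_nth /= !nth_set_nth /=.
    case: eqP => [->|_]; last exact: teq_refl.
    rewrite hT'; move: E => /= <-.
    by rewrite !catrevE !cats0 rev_cat revK; apply: teq_refl.
  have := congr1 size E; rewrite !catrevE !size_cat !size_rev /=.
  by nia.
rewrite {hT'}; elim: N l => [|n N IH] l.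
  exists l, [::]; split=> //; apply: runs_le; last first.
    apply: runs_loop_exit; apply: runs_bind.
      by apply: (runs_on_ztape hj (hTj _ _) erefl); apply: (ztape_stay l [::]).
    by rewrite set_nth2; apply: runs_ret.
  by lia.
have -> : names_word (n :: N) = word n ++ TNode :: names_word N.
  by rewrite /names_word /= -catA.
have nE : ohead (word n ++ TNode :: names_word N) != None by case: n.
have step : runs (
    bind (on k j (fun c => ((c, Stay), c != None))) (fun b : bool =>
    if b then bind (compare i j) (fun e =>
      on k j (fun c => ((c, MoveRight), if e then inr true else inl tt)))
    else ret token k (inr false))) (T1 l (word n ++ TNode :: names_word N))
    (2 * size u + size n + 7) (if u == n then inr true else inl tt)
    (T1 (TNode :: catrev (word n) l) (names_word N)).
  apply: runs_le; last first.
    apply: runs_bind.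
      by apply: (runs_on_ztape hj (hTj _ _) erefl); apply: (ztape_stay l).
    rewrite set_nth2 nE; apply: runs_bind.
      by apply: (@runs_compare _ _ _ l u n (TNode :: names_word N)) => //;
        [exact: hTi|exact: hTj].
    rewrite set_nth2 /T1.
    rewrite -(set_nth2 T j (ztape (catrev (word n) l) (TNode :: names_word N))
                       (ztape (TNode :: catrev (word n) l) (names_word N))).
    by apply: (runs_on_ztape hj (hTj _ _) erefl); apply: teq_refl.
  by lia.
have [eun|nun] := eqVneq u n.
  exists (TNode :: catrev (word n) l), (names_word N); split.
    by rewrite -catrev_catrev.
  rewrite in_cons eun eqxx /= in step *; apply/runs_loop_exit/(runs_le _ step).
  by rewrite size_cat size_map /=; nia.
have [l1 [r1 [E h]]] := IH (TNode :: catrev (word n) l).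
exists l1, r1; split; first by rewrite E -catrev_catrev.
rewrite in_cons (negbTE nun) /= in step *.
apply: runs_le (runs_loop_next step h).
by rewrite size_cat size_map /=; nia.
Qed.

End Names.

(** * The checker *)

(** Syntax as the machine sees it, with bit strings in place of ordinals; the machine is analysed on
    arbitrary lists of such nodes, without reference to a circuit. *)
Inductive named_gate : Type :=
| TrueSink
| FalseSink of seq (bool * seq bool)
| DecisionGate of seq bool & seq bool & seq bool
| ConjGate of seq bool & seq bool.

Definition named_node : Type := (seq bool * named_gate)%type.

Definition gate_word (g : named_gate) : seq token :=
  match g with
  | TrueSink => [:: TSink true]
  | FalseSink C => TSink false :: flatten [seq TLit l.1 :: word l.2 | l <- C]
  | DecisionGate x v0 v1 =>
      TDecision :: word x ++ TArc false :: word v0 ++ TArc true :: word v1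
  | ConjGate v0 v1 =>
      TConj :: TArc false :: word v0 ++ TArc true :: word v1
  end.

Definition node_word (u : named_node) : seq token :=
  TNode :: word u.1 ++ gate_word u.2.

Definition nodes_word (us : seq named_node) : seq token :=
  flatten (map node_word us).

(** The successors of a node with gate [g] along edges other than those
    setting [x] to [~~ b]. *)
Definition successors (b : bool) (x : seq bool) (g : named_gate) :
    seq (seq bool) :=
  match g with
  | DecisionGate y v0 v1 =>
      (if ~~ ((x == y) && b) then [:: v0] else [::]) ++
      (if ~~ ((x == y) && ~~ b) then [:: v1] else [::])
  | ConjGate v0 v1 => [:: v0; v1]
  | _ => [::]
  end.

Definition visit b x (N : seq (seq bool)) (u : named_node) : seq (seq bool) :=
  if u.1 \in N then N ++ successors b x u.2 else N.

(** Names appended at one node already count for the later nodes of the same scan, so [k] scans find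
    all nodes at distance at most [k], and possibly more. *)
Definition visit_all b x us N := foldl (visit b x) N us.

Lemma names_word_cat N N' :
  names_word (N ++ N') = names_word N ++ names_word N'.
Proof. by rewrite /names_word map_cat flatten_cat. Qed.

Lemma names_word_rcons N n :
  names_word (N ++ [:: n]) = names_word N ++ word n ++ [:: TNode].
Proof. by rewrite names_word_cat /names_word /= cats0. Qed.

(** Each appended name with its terminator is as long as the [TArc] and the name that follow in the
    word of [u]. *)
Lemma size_visit b x N u :
  size (names_word (visit b x N u)) <= size (names_word N) + size (node_word u).
Proof.
rewrite /visit; case: ifP => _; last by rewrite leq_addr.
rewrite names_word_cat size_cat leq_add2l.
case: u => n [|C|y v0 v1|v0 v1] //=; rewrite /names_word /=;
  repeat case: ifP => _; do 5 rewrite /= ?cats0 ?size_cat ?size_map; lia.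
Qed.

Lemma size_visit_all b x us N :
  size (names_word (visit_all b x us N)) <=
  size (names_word N) + size (nodes_word us).
Proof.
elim: us N => [|u us IH] N; first by rewrite leq_addr.
rewrite /visit_all /= -/(visit_all _ _ _ _)
  /nodes_word /= size_cat -/(nodes_word us).
have := IH (visit b x N u); have := size_visit b x N u; rewrite /=; lia.
Qed.

(** * One scan of the circuit, and its cost *)

Section Pass.
Variables (b : bool) (x : seq bool) (tI tK tA : tape (token + void)) (P : nat).
Hypothesis x_small : size x + 4 <= P.

Notation program := (prog token 6).

(** Tapes: 0 the input, 1 a copy of it traversed by each pass, 2 a copy of it
    counting the passes, 3 the list of visited nodes, 4 the name of the current
    0-sink, 5 the variable of the current literal, 6 the name of the current
    node.  The flags [s] tell whether this node has been visited and whether it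
    tests [x]. *)
Definition pass_token (s : bool * bool) (t : token) :
    program ((bool * bool) + unit) :=
  match t with
  | TNode =>
      bind (erase token 6 6) (fun _ =>
      bind (copy 6 is_bit 1 6) (fun _ =>
      bind (rewind token 6 6) (fun _ =>
      bind (member 6 6 3) (fun m => ret token 6 (inl (m, false))))))
  | TDecision => bind (compare 6 5 1) (fun e => ret token 6 (inl (s.1, e)))
  | TArc c =>
      if s.1 && ~~ (s.2 && (c == ~~ b)) then
        bind (copy 6 is_bit 1 3) (fun _ =>
          on 6 3 (fun _ => ((Some TNode, MoveRight), inl s)))
      else bind (skip 6 is_bit 1) (fun _ => ret token 6 (inl s))
  | TConj => ret token 6 (inl (s.1, false))
  | _ => ret token 6 (inl s)
  end.

Definition pass_body (s : bool * bool) : program ((bool * bool) + unit) :=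
  bind (on 6 1 (fun c => ((c, if c is Some _ then MoveRight else Stay), c)))
    (fun c : option token =>
  if c is Some t then pass_token s t else ret token 6 (inr tt)).

Definition pass_tapes (l r : seq token) N B :=
  [:: tI; ztape l r; tK; ntape (names_word N); tA; ztape [::] (word x);
     ztape [::] (word B)].

(** [runs] speaks of complete executions only. A part of an execution of the loop is therefore
    expressed by what it adds to any completion, a form that composes. *)
Definition advances s l r N B n s' l' r' N' B' : Prop :=
  forall t T2, runs (loop pass_body s') (pass_tapes l' r' N' B') t tt T2 ->
  runs (loop pass_body s) (pass_tapes l r N B) (n + t) tt T2.

Lemma advances_trans s1 l1 r1 N1 B1 n s2 l2 r2 N2 B2 n' s3 l3 r3 N3 B3 :
  advances s1 l1 r1 N1 B1 n s2 l2 r2 N2 B2 ->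
  advances s2 l2 r2 N2 B2 n' s3 l3 r3 N3 B3 ->
  advances s1 l1 r1 N1 B1 (n + n') s3 l3 r3 N3 B3.
Proof. by move=> h h' t T2 /h'/h; rewrite addnA. Qed.

Lemma advances_le s1 l1 r1 N1 B1 n n' s2 l2 r2 N2 B2 :
  advances s1 l1 r1 N1 B1 n s2 l2 r2 N2 B2 -> n <= n' ->
  advances s1 l1 r1 N1 B1 n' s2 l2 r2 N2 B2.
Proof. by move=> h hn t T2 /h; apply: runs_le; rewrite leq_add2r. Qed.

Lemma advances_body s l r N B n s' l' r' N' B' :
  runs (pass_body s) (pass_tapes l r N B) n (inl s') (pass_tapes l' r' N' B') ->
  advances s l r N B n s' l' r' N' B'.
Proof. by move=> h t T2; apply: runs_loop_next. Qed.

Lemma advances_token s t l r N B n s' l' r' N' B' :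
  runs (pass_token s t) (pass_tapes (t :: l) r N B) n (inl s')
    (pass_tapes l' r' N' B') ->
  advances s l (t :: r) N B n.+1 s' l' r' N' B'.
Proof.
move=> h; apply: advances_body; rewrite -[n.+1]add1n;
  apply: (runs_bind (l := Some t)) h.
by apply: (runs_on_ztape (l := l) (r := t :: r)) => //; apply: teq_refl.
Qed.

(** The membership test, a product of two lengths below [P], dominates; its bound 8 P^2 then serves
    as the uniform price of a token. *)
Lemma advances_node s l n r N B : stops is_bit r ->
  size n + 4 <= P -> size B + 4 <= P -> size (names_word N) + 4 <= P ->
  advances s l (TNode :: word n ++ r) N B (8 * P * P)
    (n \in N, false) (catrev (TNode :: word n) l) r N n.
Proof.
move=> hr hn hB hN; apply: advances_le.
  apply: advances_token; apply: runs_bind;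
    first exact: (@runs_erase _ _ 6 _ [::] (word B)).
  apply: runs_bind.
    by apply: (@runs_copy _ _ is_bit 1 6 _ (TNode :: l) (word n) r [::]) =>
      //; apply: all_is_bit.
  apply: runs_bind; first exact: (@runs_rewind _ _ 6 _ (catrev (word n) [::])
    [::]).
  rewrite /= catrevK; apply: runs_bind; last exact: runs_ret.
  exact: (@runs_member _ 6 3 _ n N).
by rewrite !catrevE !size_cat !size_rev !size_map /=; nia.
Qed.

Lemma advances_decision s l y r N B : stops is_bit r -> size y + 4 <= P ->
  advances s l (TDecision :: word y ++ r) N B (8 * P * P)
    (s.1, x == y) (catrev (TDecision :: word y) l) r N B.
Proof.
move=> hr hy; apply: advances_le.
  apply: advances_token; apply: runs_bind; last exact: runs_ret.
  by apply: (@runs_compare _ 5 1 _ (TDecision :: l) x y r).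
by nia.
Qed.

Lemma advances_arc s c l v r N B : stops is_bit r -> size v + 4 <= P ->
  advances s l (TArc c :: word v ++ r) N B (8 * P * P)
    s (catrev (TArc c :: word v) l) r
    (if s.1 && ~~ (s.2 && (c == ~~ b)) then N ++ [:: v] else N) B.
Proof.
move=> hr hv; apply: advances_le.
  apply: advances_token; rewrite /pass_token.
  case: ifP => _; last first.
    apply: runs_bind; last exact: runs_ret.
    apply: (runs_le (t' := P)); last first.
      by apply: (@runs_skip _ _ is_bit 1 _ (TArc c :: l) (word v) r) => //;
        apply: all_is_bit.
    by rewrite size_map; lia.
  apply: runs_bind.
    apply: (runs_le (t' := P)); last first.
      apply: (@runs_copy _ _ is_bit 1 3 _ (TArc c :: l) (word v)
        r (catrev (names_word N) [::])) => //.
      exact: all_is_bit.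
    by rewrite size_map; lia.
  rewrite /pass_tapes names_word_rcons !catrev_catl.
  by apply: (runs_on_ztape (l := catrev (word v) (catrev (names_word N) [::]))
    (r := [::])) => //; apply: teq_refl.
by nia.
Qed.

Lemma advances_conj s l r N B :
  advances s l (TConj :: r) N B (8 * P * P) (s.1, false) (TConj :: l) r N B.
Proof.
apply: advances_le; first by apply: advances_token; apply: runs_ret.
by nia.
Qed.

Definition is_skipped (t : token) : bool :=
  match t with TBit _ | TSink _ | TLit _ => true | _ => false end.

Lemma advances_skipped s l w r N B : all is_skipped w ->
  advances s l (w ++ r) N B (size w * (8 * P * P)) s (catrev w l) r N B.
Proof.
elim: w l => [|t w IH] l /=; first by move=> _ t T2.
case/andP=> ht hw; apply: advances_trans (IH (t :: l) hw).
apply: advances_le; first by apply: advances_token; case: t ht => //= *;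
  apply: runs_ret.
by nia.
Qed.

Lemma all_skipped_clause C :
  all is_skipped (flatten [seq TLit l.1 :: word l.2 | l <- C] : seq token).
Proof.
elim: C => //= l C IH; rewrite all_cat IH andbT.
by elim: l.2.
Qed.

Lemma advances_visit s l (u : named_node) r N B : stops is_bit r ->
  size (node_word u) + size (names_word N) + 4 <= P -> size B + 4 <= P ->
  exists s' B', size B' + 4 <= P /\
    advances s l (node_word u ++ r) N B (size (node_word u) * (8 * P * P))
      s' (catrev (node_word u) l) r (visit b x N u) B'.
Proof.
case: u => n g hr hu hB; set c := 8 * P * P.
suff [s' h] : exists s', advances s l (node_word (n, g) ++ r) N B
     (size (node_word (n, g)) * c)
      s' (catrev (node_word (n, g)) l) r (visit b x N (n, g)) n.
  exists s', n; split=> //.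
  by move: hu; rewrite /node_word /= size_cat size_map; lia.
have hg : stops is_bit (gate_word g ++ r) by case: g {hu}.
have hnode : advances s l (node_word (n, g) ++ r) N B c (n \in N, false)
    (catrev (TNode :: word n) l) (gate_word g ++ r) N n.
  rewrite /node_word /= -catA; apply: advances_node => //.
    by move: hu; rewrite /node_word /= size_cat size_map; lia.
  by lia.
(* [k] counts the tokens read by the loop itself; the name behind a [TDecision] or a [TArc] is
   consumed in the round of that token. *)
have [k [hk [s' h]]] : exists k, k <= size (gate_word g) /\ exists s',
    advances (n \in N, false) (catrev (TNode :: word n) l) (gate_word g ++ r)
      N n
      (k * c) s' (catrev (gate_word g) (catrev (TNode :: word n) l)) r
      (visit b x N (n, g)) n.
  move: (catrev (TNode :: word n) l) => l1 {hnode}.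
  case: g hu {hg} => [|C|y v0 v1|v0 v1] hu; rewrite /visit /=.
  - exists 1; split=> //; exists (n \in N, false); rewrite cats0 if_same.
    exact: (@advances_skipped _ _ [:: TSink true]).
  - eexists; split; last first.
      exists (n \in N, false); rewrite cats0 if_same.
      apply: (@advances_skipped _ _ (TSink false :: _)) => /=.
      exact: all_skipped_clause.
    by [].
  - exists 3; split; first by rewrite /= size_cat /= size_cat /=; lia.
    exists (n \in N, x == y).
    rewrite -!catA /= -!catA /= mulSn mulSn mul1n.
    have [hy [h0 h1]] : size y + 4 <= P /\ size v0 + 4 <= P /\ size v1 + 4 <= P.
      by move: hu; do 5 rewrite /= ?size_cat ?size_map; lia.
    apply: advances_trans; first by apply: (@advances_decision _ _ y).
    apply: advances_trans; first by apply: (@advances_arc _ false _ v0).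
    have := @advances_arc (n \in N, x == y) true
      (catrev (TArc false :: word v0) (catrev (TDecision :: word y) l1)) v1 r
      (if (n \in N) && ~~ ((x == y) && (false == ~~ b))
        then N ++ [:: v0] else N) n hr h1.
    rewrite /= !catrev_catl /= catrev_catl /=.
    by case: (n \in N); case: (x == y); case: b => /=; rewrite -?catA ?cats0.
  - exists 3; split; first by rewrite /= size_cat /=; lia.
    exists (n \in N, false).
    rewrite -!catA /= mulSn mulSn mul1n.
    have [h0 h1] : size v0 + 4 <= P /\ size v1 + 4 <= P.
      by move: hu; do 5 rewrite /= ?size_cat ?size_map; lia.
    apply: advances_trans; first by apply: advances_conj.
    apply: advances_trans; first by apply: (@advances_arc _ false _ v0).
    have := @advances_arc (n \in N, false) true
      (catrev (TArc false :: word v0) (TConj :: l1)) v1 r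
      (if (n \in N) then N ++ [:: v0] else N) n hr h1.
    rewrite /= !andbT !catrev_catl /=.
    by case: (n \in N) => /=; rewrite -?catA ?cats0.
exists s'; apply: advances_le.
  apply: (advances_trans hnode).
  by rewrite [catrev (node_word _) l](catrev_catl (TNode :: word n)); exact: h.
rewrite -mulSn leq_mul2r; apply/orP; right.
by rewrite /node_word /= size_cat; lia.
Qed.

Lemma stops_nodes us r : stops is_bit r -> stops is_bit (nodes_word us ++ r).
Proof. by case: us. Qed.

Lemma advances_visit_all s l us N B :
  size (nodes_word us) + size (names_word N) + 4 <= P -> size B + 4 <= P ->
  exists s' B', size B' + 4 <= P /\
    advances s l (nodes_word us) N B (size (nodes_word us) * (8 * P * P))
      s' (catrev (nodes_word us) l) [::] (visit_all b x us N) B'.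
Proof.
elim: us s l N B => [|u us IH] s l N B hu hB.
  by exists s, B; split=> // t T2.
move: hu; rewrite -[nodes_word (u :: us)]/(node_word u ++ nodes_word us)
  size_cat => hu.
have [||s1 [B1 [hB1 h1]]] := @advances_visit s l u (nodes_word us) N B _ _ hB.
- by rewrite -[nodes_word us]cats0; apply: stops_nodes.
- by lia.
have [|s2 [B2 [hB2 h2]]] :=
    IH s1 (catrev (node_word u) l) (visit b x N u) B1 _ hB1.
  by have := size_visit b x N u; lia.
exists s2, B2; split=> //.
by rewrite catrev_catl mulnDl; apply: advances_trans h1 h2.
Qed.

Definition pass : program unit :=
  bind (rewind token 6 1) (fun _ => loop pass_body (false, false)).

Lemma runs_pass l r src us N B :
  catrev l r = word src ++ nodes_word us ->
  size (word src ++ nodes_word us) + size (names_word N) + 4 <= P ->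
  size B + 4 <= P ->
  exists2 B', size B' + 4 <= P &
    runs pass (pass_tapes l r N B) (8 * P * P * P) tt
      (pass_tapes (catrev (word src ++ nodes_word us) [::]) [::]
         (visit_all b x us N) B').
Proof.
move=> E hN hB; move: (hN); rewrite size_cat => hN'.
have [|s [B' [hB' h]]] := @advances_visit_all (false, false)
    (catrev (word src) [::]) us N B _ hB; first by lia.
exists B' => //; apply: runs_le; last first.
  apply: runs_bind; first exact: (@runs_rewind _ _ 1 _ l r).
  have hsrc : all is_skipped (word src) by elim: (src).
  have {}h := advances_trans (advances_skipped hsrc) h.
  rewrite /= E; apply: (h _ _).
  rewrite catrev_catl; apply: runs_loop_exit; apply: runs_bind.
    by apply: (runs_on_ztape (l := catrev (nodes_word us) (catrev (word src)
      [::]))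
       (r := [::]) (t := ztape (catrev (nodes_word us) (catrev (word src)
         [::])) [::])) => //; apply: ztape_stay.
  exact: runs_ret.
have := size_le_catrev l r; rewrite E size_cat.
(* The tokens cost at most (P - 4) c; the remaining 4 c covers the rewinding and the final blank. *)
have hc : P <= 8 * P * P by nia.
move: (8 * P * P) hc (size (word src)) (size (nodes_word us)) hN' =>
  c hc m1 m2 hm hl.
have h1 : (m1 + m2) * c <= (P - 4) * c by rewrite leq_mul2r; apply/orP; right;
  lia.
nia.
Qed.

End Pass.

Notation program := (prog token 6).

Definition count_passes (b : bool) : program unit :=
  loop (fun _ : unit =>
    bind (on 6 2 (fun c => ((c, if c is Some _ then MoveRight else Stay), c)))
      (fun c : option token =>
    if c is Some _ then bind (pass b) (fun _ => ret token 6 (inl tt))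
    else ret token 6 (inr tt))) tt.

(** The input begins with the name of the source, so its leading bits are the initial list. *)
Definition search (b : bool) : program bool :=
  bind (rewind token 6 1) (fun _ =>
  bind (erase token 6 3) (fun _ =>
  bind (copy 6 is_bit 1 3) (fun _ =>
  bind (on 6 3 (fun _ => ((Some TNode, MoveRight), tt))) (fun _ : unit =>
  bind (rewind token 6 2) (fun _ =>
  bind (count_passes b) (fun _ => member 6 4 3)))))).

(** Literals occur only in the word of a 0-sink, so at a [TLit] tape 4 holds the name of the sink
    whose clause is being read. *)
Definition main_token (t : token) : program (unit + bool) :=
  match t with
  | TNode =>
      bind (erase token 6 4) (fun _ =>
      bind (copy 6 is_bit 0 4) (fun _ =>
      bind (rewind token 6 4) (fun _ => ret token 6 (inl tt))))
  | TLit b =>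
      bind (erase token 6 5) (fun _ =>
      bind (copy 6 is_bit 0 5) (fun _ =>
      bind (rewind token 6 5) (fun _ =>
      bind (search b) (fun f =>
        ret token 6 (if f then inr false else inl tt)))))
  | _ => ret token 6 (inl tt)
  end.

Definition main_loop : program bool :=
  loop (fun _ : unit =>
    bind (on 6 0 (fun c => ((c, if c is Some _ then MoveRight else Stay), c)))
      (fun c : option token =>
    if c is Some t then main_token t else ret token 6 (inr true))) tt.

Definition checker : program bool :=
  bind (copy 6 predT 0 1) (fun _ =>
  bind (rewind token 6 0) (fun _ =>
  bind (copy 6 predT 0 2) (fun _ =>
  bind (rewind token 6 0) (fun _ => main_loop)))).

(** * Outcome and running time of the whole checker *)

Section Main.
Variables (src : seq bool) (us : seq named_node).

Let W := word src ++ nodes_word us.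
Let n := size W.
(** The initial list has length at most n + 1 and n scans add at most n each; the square exceeds
    this sum by enough for the slack terms below. *)
Let P := (n + 3) * (n + 3).

Definition reached (b : bool) (x : seq bool) : seq (seq bool) :=
  iter n (visit_all b x us) [:: src].

(** Induction on the unread part [r] of the counter. The term [size r * n] reserves room on the list
    for the scans still to come. *)
Lemma runs_count_passes b x tI tA l r lG rG N B :
  size x + 4 <= P -> catrev lG rG = W ->
  size (names_word N) + size r * n + n + 4 <= P -> size B + 4 <= P ->
  exists lG' rG' B', [/\ catrev lG' rG' = W, size B' + 4 <= P &
    runs (count_passes b)
      [:: tI; ztape lG rG; ztape l r; ntape (names_word N); tA;
          ztape [::] (word x); ztape [::] (word B)]
      ((size r).+1 * (9 * P * P * P)) tt
      [:: tI; ztape lG' rG'; ztape (catrev r l) [::];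
          ntape (names_word (iter (size r) (visit_all b x us) N)); tA;
          ztape [::] (word x); ztape [::] (word B')]].
Proof.
move=> hx; elim: r l lG rG N B => [|t r IH] l lG rG N B hG hN hB.
  exists lG, rG, B; split=> //; apply: runs_le; last first.
    apply: runs_loop_exit; apply: runs_bind.
      by apply: (runs_on_ztape (l := l) (r := [::]) (t :=
        ztape l [::])) => //; apply: ztape_stay.
    exact: runs_ret.
  by nia.
have [|B1 hB1 h1] := @runs_pass b x tI (ztape (t :: l) r)
  tA P hx lG rG src us N B hG _ hB.
  by rewrite -/W -/n; move: hN; rewrite /=; nia.
have [||lG' [rG' [B' [hG' hB' h]]]] :=
  IH (t :: l) (catrev W [::]) [::] (visit_all b x us N) B1 _ _ hB1.
- exact: catrevK.
- have := size_visit_all b x us N; have : size (nodes_word us) <= n.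
    by rewrite /n /W size_cat leq_addl.
  by move: hN; rewrite /=; nia.
exists lG', rG', B'; split=> //; apply: runs_le; last first.
  rewrite [iter _ _ _]iterSr; apply: (runs_loop_next _ h).
  apply: (runs_bind (l := Some t)).
    by apply: (runs_on_ztape (l := l) (r := t :: r) (t :=
      ztape (t :: l) r)) => //; apply: teq_refl.
  by apply: (runs_bind h1); apply: runs_ret.
have h4 : 4 <= P by lia.
have h3 : 2 <= P * P * P by nia.
by rewrite /=; nia.
Qed.

(** Invariant of the main loop: searches leave heads and contents behind that are known only up to
    their length, while the name [a] on tape 4 must survive them. *)
Inductive ready l r a : seq (tape (token + void)) -> Prop :=
  Ready lG rG lK rK lN x B of
    catrev l r = W & catrev lG rG = W & catrev lK rK = W &
    size lN + 4 <= P & size a + 4 <= P & size x + 4 <= P & size B + 4 <= P :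
  ready l r a
    [:: ztape l r; ztape lG rG; ztape lK rK; ztape lN [::];
        ztape [::] (word a); ztape [::] (word x); ztape [::] (word B)].

Lemma runs_search b l r a lG rG lK rK lN x B :
  catrev l r = W -> catrev lG rG = W -> catrev lK rK = W ->
  size lN + 4 <= P -> size a + 4 <= P -> size x + 4 <= P -> size B + 4 <= P ->
  exists2 T', ready l r a T' &
    runs (search b)
    [:: ztape l r; ztape lG rG; ztape lK rK; ztape lN [::];
        ztape [::] (word a); ztape [::] (word x); ztape [::] (word B)]
    (20 * (P * P * P * P)) (a \in reached b x) T'.
Proof.
move=> h hG hK hN ha hx hB.
have hsrc : size src <= n by rewrite /n /W size_cat size_map leq_addr.
have hn0 : names_word [:: src] = word src ++ [:: TNode] by rewrite /names_word
  /= cats0.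
have [||lG' [rG' [B' [hG' hB' hp]]]] := @runs_count_passes b x (ztape l r)
   (ztape [::] (word a)) [::] W (catrev (word src) [::]) (nodes_word us)
   [:: src] B hx _ _ hB.
- by rewrite catrev_catrev.
- by rewrite hn0 size_cat size_map /= -/n /P; nia.
have hL : size (names_word (reached b x)) + 4 <= P.
  have hl k : size (names_word (iter k (visit_all b x us) [:: src]))
    <= n.+1 + k * n.
    elim: k => [|k IH]; first by rewrite /= hn0 size_cat size_map /=; lia.
    rewrite iterS; apply: leq_trans (size_visit_all _ _ _ _) _.
    have : size (nodes_word us) <= n by rewrite /n /W size_cat leq_addl.
    by rewrite mulSn; lia.
  by have := hl n; rewrite -/(reached b x) /P; nia.
exists [:: ztape l r; ztape lG' rG'; ztape (catrev W [::]) [::];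
      ntape (names_word (reached b x)); ztape [::] (word a);
      ztape [::] (word x); ztape [::] (word B')].
  by constructor=> //; [exact: catrevK|rewrite catrevE cats0 size_rev].
apply: runs_le; last first.
  apply: runs_bind; first exact: (@runs_rewind _ 6 1 _ lG rG).
  apply: runs_bind; first exact: (@runs_erase _ 6 3 _ lN [::]).
  apply: runs_bind.
    apply: (@runs_copy _ 6 is_bit 1 3 _ [::] (word src) (nodes_word us) [::])
      => //.
    - exact: all_is_bit.
    - by rewrite -[nodes_word us]cats0; apply: stops_nodes.
    - by rewrite /= hG.
  apply: runs_bind.
    apply: (runs_on_ztape (l := catrev (word src) [::]) (r := [::])
      (t := ntape (names_word [:: src]))) => //.
    by rewrite hn0 catrev_catl; apply: teq_refl.
  apply: runs_bind; first exact: (@runs_rewind _ 6 2 _ lK rK).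
  rewrite hK; apply: (runs_bind hp).
  by apply: (@runs_member 6 4 3 _ a (reached b x)).
rewrite size_map -/n.
have := size_le_catrev lG rG; rewrite hG -/n => hlG.
have := size_le_catrev lK rK; rewrite hK -/n => hlK.
have hnP : n + 4 <= P by rewrite /P; nia.
have e1 : (2 * size a + 11) * (size (names_word (reached b x))).+2 <= 2 * (P *
  P) + 3 * P by nia.
have e2 : n.+1 * (9 * P * P * P) <= P * (9 * P * P * P) by rewrite leq_mul2r;
  apply/orP; right; lia.
move: e1 e2; set u := (2 * size a + 11) * _; set v := n.+1 * _ => e1 e2.
(* Comparing consecutive powers of [P] makes the final inequality linear in these powers. *)
have p2 : P <= P * P by nia.
have p3 : P * P <= P * P * P by nia.
have p4 : P * P * P <= P * P * P * P by nia.
have e3 : P * (9 * P * P * P) = 9 * (P * P * P * P) by nia.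
rewrite e3 in e2; rewrite /= -/u; move: p2 p3 p4 hnP hsrc hlG hlK hN e1 e2.
clearbody u v; clear; clearbody P n.
by move: (size lG) (size lK) (size lN) => *; lia.
Qed.

(** [m] bounds the remaining rounds of the main loop, each priced at the cost of a search. *)
Definition decides T m o : Prop :=
  exists T', runs main_loop T (m * (30 * (P * P * P * P))) o T'.

Lemma decides_le T m m' o : m <= m' -> decides T m o -> decides T m' o.
Proof.
move=> hm [T' h]; exists T'; apply: runs_le h.
by rewrite leq_mul2r hm orbT.
Qed.

Lemma decides_token t l r tT c m o T1 :
  runs (main_token t) (ztape (t :: l) r :: tT) (29 * (P * P * P * P)) c T1 ->
  match c with inl _ => decides T1 m o | inr b => b = o end ->
  decides (ztape l (t :: r) :: tT) m.+1 o.
Proof.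
move=> hr hc.
(* The step that reads the token is paid for by raising 29 to 30, which needs P^4 to be positive. *)
have p4 : 0 < P * P * P * P by rewrite !muln_gt0; lia.
have hb : runs (
    bind (on 6 0 (fun c => ((c, if c is Some _ then MoveRight else Stay), c)))
      (fun c : option token =>
    if c is Some t then main_token t else ret token 6 (inr true)))
    (ztape l (t :: r) :: tT) (30 * (P * P * P * P)) c T1.
  apply: (runs_le (t := 1 + 29 * (P * P * P * P))); first by lia.
  apply: (runs_bind (l := Some t)) hr.
  by apply: (runs_on_ztape (l := l) (r := t :: r) (t :=
    ztape (t :: l) r)) => //; apply: teq_refl.
case: c hc hb {hr} => [[] [T2 h]|b <-] hb; last first.
  exists T1; apply: runs_le (runs_loop_exit hb).
  by rewrite leq_pmull.
by exists T2; rewrite mulSn; apply: (runs_loop_next hb h).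
Qed.

Lemma decides_other t l r a T m o :
  match t with TNode | TLit _ => false | _ => true end ->
  ready l (t :: r) a T ->
  (forall T', ready (t :: l) r a T' -> decides T' m o) ->
  decides T m.+1 o.
Proof.
move=> ht [lG rG lK rK lN x B h1 h2 h3 h4 h5 h6 h7] hm.
have hT' := hm _ (@Ready (t :: l) r a _ _ _ _ _ _ _ h1 h2 h3 h4 h5 h6 h7).
apply: (decides_token (c := inl tt)) hT'.
apply: (runs_le (t := 1)); first by rewrite !muln_gt0; lia.
by case: t ht {h1 hm} => // *; apply: runs_ret.
Qed.

Lemma decides_others w l r a T m o :
  all (fun t => match t with TNode | TLit _ => false | _ => true end) w ->
  ready l (w ++ r) a T ->
  (forall T', ready (catrev w l) r a T' -> decides T' m o) ->
  decides T (size w + m) o.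
Proof.
elim: w l T => [|t w IH] l T /=; first by move=> _ hT /(_ _ hT).
by case/andP=> ht hw /(decides_other ht) h hm; apply: h => T' /IH; apply.
Qed.

Lemma read_small l t u r :
  catrev l (t :: word u ++ r) = W -> size u + 4 <= P.
Proof.
move=> h; have : size u <= n.
  by rewrite /n -h catrevE size_cat /= size_cat size_map; lia.
by rewrite /P; nia.
Qed.

Lemma decides_node l u r a T m o : stops is_bit r ->
  ready l (TNode :: word u ++ r) a T ->
  (forall T', ready (catrev (TNode :: word u) l) r u T' -> decides T' m o) ->
  decides T m.+1 o.
Proof.
move=> hr [lG rG lK rK lN x B h1 h2 h3 h4 h5 h6 h7] hm.
have hu := read_small h1.
have h1' : catrev (catrev (TNode :: word u) l) r = W by rewrite catrev_catrev.
have hT' := hm _ (Ready h1' h2 h3 h4 hu h6 h7).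
apply: (decides_token (c := inl tt)) hT'.
apply: runs_le; last first.
  apply: runs_bind; first exact: (@runs_erase _ 6 4 _ [::] (word a)).
  apply: runs_bind.
    by apply: (@runs_copy _ 6 is_bit 0 4 _ (TNode :: l) (word u) r [::]) =>
      //; apply: all_is_bit.
  apply: runs_bind; last exact: runs_ret.
  have := @runs_rewind _ 6 4 [:: ztape (catrev (TNode :: word u) l) r;
    ztape lG rG; ztape lK rK; ztape lN [::];
      ztape (catrev (word u) [::]) [::]; ztape [::] (word x);
        ztape [::] (word B)] (catrev (word u) [::]) [::] isT erefl.
  by rewrite /= catrevK; apply.
rewrite !size_map catrevE size_cat size_rev size_map /=.
have p1 : 4 <= P by lia.
have p2 : P <= P * P by nia.
have p3 : P * P <= P * P * P by nia.
have p4 : P * P * P <= P * P * P * P by nia.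
by lia.
Qed.

(** A successful search rejects at once, whatever verdict [o] the rest of the input would give. *)
Lemma decides_literal l b y r a T m o : stops is_bit r ->
  ready l (TLit b :: word y ++ r) a T ->
  (forall T', ready (catrev (TLit b :: word y) l) r a T' -> decides T' m o) ->
  decides T m.+1 ((a \notin reached b y) && o).
Proof.
move=> hr [lG rG lK rK lN x B h1 h2 h3 h4 h5 h6 h7] hm.
have hy := read_small h1.
have h1' : catrev (catrev (TLit b :: word y) l) r = W by rewrite catrev_catrev.
have [T' hT' h] := runs_search b h1' h2 h3 h4 h5 hy h7.
apply: (decides_token (c := if a \in reached b y then inr false else inl tt)
  (T1 := T')); last by case: ifP => _ //=; exact: hm.
apply: runs_le; last first.
  apply: runs_bind; first exact: (@runs_erase _ 6 5 _ [::] (word x)).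
  apply: runs_bind.
    by apply: (@runs_copy _ 6 is_bit 0 5 _ (TLit b :: l) (word y) r [::]) =>
      //; apply: all_is_bit.
  apply: runs_bind.
    exact: (@runs_rewind _ 6 5 _ (catrev (word y) [::]) [::]).
  rewrite catrevK; apply: (runs_bind h).
  by case: ifP => _; apply: runs_ret.
rewrite !size_map catrevE size_cat size_rev size_map /=.
have p1 : 4 <= P by lia.
have p2 : P <= P * P by nia.
have p3 : P * P <= P * P * P by nia.
have p4 : P * P * P <= P * P * P * P by nia.
by lia.
Qed.

Lemma decides_clause C l r a T m o : stops is_bit r ->
  ready l (flatten [seq TLit c.1 :: word c.2 | c <- C] ++ r) a T ->
  (forall T',
     ready (catrev (flatten [seq TLit c.1 :: word c.2 | c <- C]) l) r a T' ->
     decides T' m o) ->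
  decides T (size C + m) (all (fun c => a \notin reached c.1 c.2) C && o).
Proof.
move=> hr; elim: C l T => [|[b y] C IH] l T /=;
  first by move=> hT /(_ _ hT).
rewrite -catA => hT hm; rewrite -andbA; apply: (decides_literal _ hT).
  by case: (C) {hT hm IH}.
by move=> T' /IH; apply=> T2; rewrite -catrev_catl; apply: hm.
Qed.

Definition passes (u : named_node) : bool :=
  if u.2 is FalseSink C then all (fun c => u.1 \notin reached c.1 c.2) C
  else true.

(** Only the nodes still to be read shrink in the induction; [passes] always searches the whole
    circuit [us]. *)
Lemma decides_nodes vs l a T : ready l (nodes_word vs) a T ->
  decides T (size (nodes_word vs)).+1 (all passes vs).
Proof.
elim: vs l a T => [|[u g] vs IH] l a T hT.
  case: hT => lG rG lK rK lN x B *; eexists; apply: runs_le; last first.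
    apply: runs_loop_exit; apply: runs_bind.
      by apply: (runs_on_ztape (l := l) (r := [::]) (t :=
        ztape l [::])) => //; apply: ztape_stay.
    exact: runs_ret.
  have p4 : 0 < P * P * P * P by rewrite !muln_gt0; lia.
  by lia.
move: hT; rewrite -[nodes_word (_ :: vs)]/((TNode :: word u ++ gate_word g)
  ++ nodes_word vs).
rewrite [_ ++ nodes_word vs]/= -catA => hT.
have hvs : stops is_bit (nodes_word vs) by case: (vs).
have hstop : stops is_bit (gate_word g ++ nodes_word vs) by case: (g).
apply: (decides_le (m := (size (gate_word g) + (size (nodes_word vs)).+1).+1)).
  by rewrite /= !size_cat; lia.
apply: (decides_node hstop hT) => T1 hT1; rewrite [all _ _]/=.
have {}IH l' T' : ready l' (nodes_word vs) u T' ->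
  decides T' (size (nodes_word vs)).+1 (all passes vs) by apply: IH.
have hw v :
    all (fun t => match t with TNode | TLit _ => false | _ => true end) (word v).
  by elim: v.
case: g hT1 {hT hstop} => [|C|y v0 v1|v0 v1] hT1.
- by apply: decides_others hT1 _ => // T2 /IH.
- apply: (decides_le (m := (size C + (size (nodes_word vs)).+1).+1)).
    suff : size C <= size (flatten [seq TLit c.1 :: word c.2 | c <- C]).
      by rewrite /=; lia.
    by elim: (C) => //= c C' hC; rewrite size_cat; lia.
  apply: (decides_other _ hT1) => // T2 hT2.
  by apply: (decides_clause hvs hT2) => T3 /IH.
- by apply: decides_others hT1 _ => [|T2 /IH //];
  rewrite /= !all_cat /= all_cat /= !hw.
- by apply: decides_others hT1 _ => [|T2 /IH //]; rewrite /= !all_cat /= !hw.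
Qed.

Lemma runs_checker : exists T', runs checker
  [:: ztape [::] W; ztape [::] [::]; ztape [::] [::]; ztape [::] [::];
      ztape [::] [::]; ztape [::] [::]; ztape [::] [::]]
  (40 * (P * P * P * P * P)) (all passes us) T'.
Proof.
have hW : decides
    [:: ztape [::] W; ztape (catrev W [::]) [::]; ztape (catrev W [::]) [::];
        ztape [::] [::]; ztape [::] (word [::]); ztape [::] (word [::]);
        ztape [::] (word [::])]
    (size (word src) + (size (nodes_word us)).+1) (all passes us).
  apply: (@decides_others _ [::] (nodes_word us) [::]); first by elim: (src).
    by constructor=> //=; rewrite ?catrevK // /P; lia.
  by move=> T' /decides_nodes.
have [T' h] := hW; exists T'; apply: runs_le; last first.
  apply: runs_bind.
    by apply: (@runs_copy _ 6 predT 0 1 _ [::] W [::] [::]) => //;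
      rewrite ?all_predT ?cats0.
  apply: runs_bind; first exact: (@runs_rewind _ 6 0 _ (catrev W [::]) [::]).
  rewrite catrevK; apply: runs_bind.
    by apply: (@runs_copy _ 6 predT 0 2 _ [::] W [::] [::]) => //;
      rewrite ?all_predT ?cats0.
  apply: runs_bind; first exact: (@runs_rewind _ 6 0 _ (catrev W [::]) [::]).
  by rewrite catrevK; exact: h.
rewrite !catrevE !size_cat !size_rev -/n addnS -size_cat -/W -/n.
have p1 : n + 4 <= P by rewrite /P; lia.
have p2 : P <= P * P by nia.
have p3 : P * P <= P * P * P by nia.
have p4 : P * P * P <= P * P * P * P by nia.
have p5 : P * P * P * P <= P * P * P * P * P by nia.
(* The main loop has n + 1 rounds; the initial copies and rewinds are linear and fit into the other
   10 P^5. *)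
have : n.+1 * (30 * (P * P * P * P)) <= P * (30 * (P * P * P * P)).
  by rewrite leq_mul2r; apply/orP; right; lia.
have -> : P * (30 * (P * P * P * P)) = 30 * (P * P * P * P * P) by lia.
by rewrite /=; lia.
Qed.

End Main.

(** * Reachability in the circuit *)

Definition bits (k : nat) : seq bool :=
  if bin_of_nat k is Npos p then bits_of_pos p else [::].

Lemma bits_of_pos_inj : injective bits_of_pos.
Proof.
(* Separates [xH] from [xI p], whose words agree in the first digit. *)
have nz p : bits_of_pos p <> [::] by case: p.
by elim=> [p IH|p IH|] [q|q|] //= [] => [/IH->|/nz|/IH->|/esym/nz].
Qed.

Lemma bits_inj : injective bits.
Proof.
move=> k k' e; apply: (can_inj bin_of_natK); move: e; rewrite /bits.
have nz p : bits_of_pos p <> [::] by case: p.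
by case: (bin_of_nat k) (bin_of_nat k') => [|p] [|q] // =>
  [/esym/nz|/nz|/bits_of_pos_inj->].
Qed.

Section Semantics.
Variables (n m : nat) (D : certified_circuit n m).

Definition node_of (u : 'I_m) : named_node :=
  (bits u, match gate_of D u with
           | Sink true => TrueSink
           | Sink false =>
               FalseSink [seq (l.2, bits l.1) | l : 'I_n * bool <- clause_of D u]
           | Decision x v0 v1 => DecisionGate (bits x) (bits v0) (bits v1)
           | Conj v0 v1 => ConjGate (bits v0) (bits v1)
           end).

Notation nodes := (map node_of (enum 'I_m)).

Lemma encodeE : encode D = word (bits (source D)) ++ nodes_word nodes.
Proof.
congr (_ ++ _); rewrite /nodes_word -map_comp; congr flatten.
apply: eq_map => u; rewrite /node_of /node_word /=; congr (_ :: _ ++ _).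
by case: (gate_of D u) => [[]|x v0 v1|v0 v1] //=; rewrite -map_comp.
Qed.

Definition arc_avoiding (b : bool) (x : 'I_n) : rel 'I_m := [rel u v |
  [exists c, (target D u c == Some v) && ~~ (tests D u x && (c == ~~ b))]].

Lemma successorsP b (x : 'I_n) (u : 'I_m) (z : seq bool) :
  reflect (exists2 v : 'I_m, z = bits v & arc_avoiding b x u v)
    (z \in successors b (bits x) (node_of u).2).
Proof.
have eqb (y : 'I_n) : (bits x == bits y) = (y == x).
  by rewrite (inj_eq bits_inj) eq_sym.
apply: (iffP idP) => [|[v -> /existsP[c]]];
  rewrite /arc_avoiding /node_of /target /tests /=.
  case: (gate_of D u) => [[]|y v0 v1|v0 v1] //=.
    rewrite eqb mem_cat => /orP[]; case: ifP => // h; rewrite inE => /eqP->.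
      by exists v0 => //; apply/existsP; exists false; rewrite eqxx; case: b h.
    by exists v1 => //; apply/existsP; exists true; rewrite eqxx; case: b h.
  rewrite !inE => /orP[]/eqP->.
    by exists v0 => //; apply/existsP; exists false; rewrite eqxx.
  by exists v1 => //; apply/existsP; exists true; rewrite eqxx.
case: (gate_of D u) => [[]|y v0 v1|v0 v1] //=.
  rewrite eqb mem_cat => /andP[/eqP[<-]].
  by case: c; case: b; case: (y == x) => //= _; rewrite ?inE ?eqxx ?orbT.
by case: c => /andP[/eqP[<-] _]; rewrite !inE eqxx ?orbT.
Qed.

Lemma visit_sub b x N u : {subset N <= visit b x N u}.
Proof. by move=> z hz; rewrite /visit; case: ifP; rewrite ?mem_cat hz. Qed.

Lemma visit_all_sub b x us N : {subset N <= visit_all b x us N}.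
Proof.
by elim: us N => [|u us IH] N z hz //; apply: IH; apply: visit_sub.
Qed.

(** The list only grows during a scan, so [u] is still in it when its turn comes. *)
Lemma visit_all_succ b x (s : seq 'I_m) N u z : u \in s -> bits u \in N ->
  z \in successors b x (node_of u).2 -> z \in visit_all b x (map node_of s) N.
Proof.
elim: s N => [|v s IH] N //; rewrite inE => /orP[/eqP<-|hu] hN hz.
  apply: (@visit_all_sub b x _ (visit b x N (node_of u))).
  by rewrite /visit ifT ?mem_cat ?hz ?orbT.
by apply: IH => //; apply: visit_sub.
Qed.

(** Soundness of a scan, used with [R] saying that a name belongs to a reachable node. *)
Lemma visit_all_ind (R : seq bool -> Prop) b x (s : seq 'I_m) N :
  (forall (u : 'I_m) z,
     R (bits u) -> z \in successors b x (node_of u).2 -> R z) ->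
  (forall z, z \in N -> R z) ->
  forall z, z \in visit_all b x (map node_of s) N -> R z.
Proof.
move=> h; elim: s N => [|u s IH] N hN //; apply: IH => z.
rewrite /visit; case: ifP => [hu|_]; last exact: hN.
by rewrite mem_cat => /orP[/hN //|]; apply: h; apply: hN.
Qed.

Lemma mem_reached b (x : 'I_n) (a : 'I_m) :
  (bits a \in reached (bits (source D)) nodes b (bits x)) =
  connect (arc_avoiding b x) (source D) a.
Proof.
rewrite /reached; apply/idP/idP.
  set k := size _; suff h z : z \in iter k (visit_all b (bits x) nodes)
    [:: bits (source D)] ->
      exists2 v : 'I_m, z = bits v & connect (arc_avoiding b x) (source D) v.
    by case/h=> v /bits_inj/val_inj->.
  elim: k z => [|k IH] z; first by rewrite inE => /eqP->; exists (source D).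
  rewrite iterS; apply: visit_all_ind IH z => u z [v /= hv cv].
  move/bits_inj/val_inj: hv => -> in cv * => /successorsP[w -> hw].
  by exists w => //; apply: connect_trans cv (connect1 hw).
(* A duplicate-free path has fewer than [m] edges and every node has a token of its own, so there
   are at least as many scans as edges. *)
case/connectP=> p0 /shortenP[p hp hu _ ->] {p0}.
have: size p <= size (word (bits (source D)) ++ nodes_word nodes).
  have h1 : size p < m.
    by have := card_uniqP hu; have := max_card (mem (source D :: p));
      rewrite card_ord /= => ? <-.
  have : m <= size (nodes_word nodes).
    rewrite -[X in X <= _]card_ord cardE.
    elim: (enum _) => // u us IH; rewrite map_cons.
    rewrite -[nodes_word _]/(node_word (node_of u)
      ++ nodes_word (map node_of us)).
    by rewrite size_cat -[size (u :: us)]/(1 + size us); apply: leq_add IH.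
  by rewrite size_cat; lia.
move: (size (_ ++ _)) => k {hu}.
elim: k p hp => [|k IH] p; first by case: p => // _ _; rewrite inE.
(* The path is cut at its end: after [k] scans its last node but one is listed, and the next scan
   appends [v]. *)
case/lastP: p => [_ _|p v].
  by rewrite iterS; apply: visit_all_sub; apply: (IH [::]).
rewrite rcons_path last_rcons size_rcons => /andP[hp hv] hk.
rewrite iterS; apply: (@visit_all_succ _ _ _ _ (last (source D) p)).
- by rewrite mem_enum.
- exact: IH.
- by apply/successorsP; exists v.
Qed.

Lemma walk_connect b (x : 'I_n) u p v : walk D u p v ->
  {in p, forall e, ~~ (tests D e.1 x && (e.2 == ~~ b))} ->
  connect (arc_avoiding b x) u v.
Proof.
elim: p u => [|[u' c] p IH] u /=; first by move/eqP->.
case/andP=> /eqP->; case E: target => [w|] // hw hp.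
apply: (@connect_trans _ _ w); last first.
  by apply: IH => // e he; apply: hp; rewrite inE he orbT.
by apply/connect1/existsP; exists c; rewrite E eqxx (hp (u, c)) // mem_head.
Qed.

(** [arc_avoiding] merges parallel edges; its existential picks a permitted one for each step of the
    walk. *)
Lemma connect_walk b (x : 'I_n) u v : connect (arc_avoiding b x) u v ->
  exists2 p, walk D u p v
    & {in p, forall e, ~~ (tests D e.1 x && (e.2 == ~~ b))}.
Proof.
case/connectP=> q; elim: q u => [|w q IH] u /=; first by move=> _ ->;
  exists [::] => /=.
case/andP=> /existsP[c /andP[/eqP hc hx]] hq hv.
have [p hp hpx] := IH _ hq hv; exists ((u, c) :: p);
  first by rewrite /= eqxx hc.
by move=> e; rewrite inE => /orP[/eqP->|/hpx].
Qed.

(** Turns the count in [read_once] into uniqueness of the edge of a path that leaves a node testing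
    a given variable. *)
Lemma count_le1_inj (T : eqType) (a : pred T) (s : seq T) e e' :
  count a s <= 1 -> e \in s -> e' \in s -> a e -> a e' -> e = e'.
Proof.
rewrite -size_filter => h he he' ae ae'.
have: e \in filter a s by rewrite mem_filter ae.
have: e' \in filter a s by rewrite mem_filter ae'.
by case: (filter a s) h => [|z [|]] //= _; rewrite !inE => /eqP-> /eqP->.
Qed.

(** A violation needs just one literal [(x, b)] true under [tau]. Hence only the value at [x]
    constrains the path; the other values can be read off the path, consistently because of
    [read_once]. *)
Lemma correctP : is_dec_dnnf D -> correct D <->
  (forall a, gate_of D a = Sink false -> forall l, l \in clause_of D a ->
     ~~ connect (arc_avoiding l.2 l.1) (source D) a).
Proof.
move=> hD; split=> [hc a ha [x b] hl|h tau a ha [p hp hcomp]].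
  apply/negP => /= /connect_walk[p hp hpx].
  (* [tau] follows the labels on [p] and is false at variables that [p] does not test; [x] is set
     apart because it may be one of these. *)
  pose tau := [ffun y => if y == x then b
                         else has (fun e => tests D e.1 y && e.2) p].
  have := hc tau a ha; rewrite /clause_eval => /(_ _)/negbT/hasPn/(_ _ hl) /=.
  rewrite ffunE eqxx eqxx => /(_ _)/negP; case=> //; exists p => //.
  case=> [u c] y he /= hy; rewrite ffunE.
  have huniq := @count_le1_inj _ _ p _ _ (read_once hD y hp ha).
  case: eqP => [ey|_].
    have := hpx _ he; rewrite /= -ey hy /=.
    by case: (c) he; case: (b).
  suff -> : has (fun e => tests D e.1 y && e.2) p = c by [].
  apply/hasP/idP => [[e he' /andP[hy' ce]]|hc'].
    by have := huniq _ _ he' he hy' hy => E; rewrite E in ce.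
  by exists (u, c); rewrite ?hy.
apply/negbTE/hasPn => -[x b] hl /=; apply/negP => /eqP htau.
have /negP := h a ha _ hl; apply; apply: (walk_connect hp) => -[u c] he /=.
apply/negP => /andP[hx /eqP hcb].
(* Compatibility puts the edge labelled [tau x] on [p]; uniqueness identifies it with [(u, c)], so
   [c] is [b] and not [~~ b]. *)
have he' := hcomp _ _ he hx.
have := @count_le1_inj _ _ p _ _ (read_once hD x hp ha) he he' hx hx.
by rewrite htau => -[] E; move: hcb; rewrite E; case: (b).
Qed.

Lemma passesP : is_dec_dnnf D ->
  all (passes (bits (source D)) nodes) nodes <-> correct D.
Proof.
move=> hD; rewrite (correctP hD) all_map; split=> [/allP h a ha l hl|h].
  have := h a; rewrite mem_enum => /(_ isT); rewrite /= /passes /= ha.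
  move=> /allP/(_ (l.2, bits l.1)); rewrite mem_reached; apply.
  by apply/mapP; exists l.
apply/allP => a _; rewrite /= /passes /=.
case E: (gate_of D a) => [[]|x v0 v1|v0 v1] //=.
by apply/allP => _ /mapP[l hl ->] /=; rewrite mem_reached; apply: h.
Qed.

End Semantics.

Theorem theorem3 :
  exists (M : machine token) (p : {poly nat}),
    forall (n m : nat) (D : certified_circuit n m),
      is_dec_dnnf D ->
      exists2 b : bool,
        answers_within M (encode D) (p.[size (encode D)])%R b & (b <-> correct D).
Proof.
exists (machine_of checker).
(* This is 40 P^5 with P the square of the input length plus 3. *)
exists ((40%N)%:P * ('X + (3%N)%:P) ^+ 10)%R => n m D hD.
eexists; last exact: passesP hD.
have [T' [s [T1 [hs hT1 hexec]]]] :=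
  runs_checker (bits (source D)) [seq node_of D u | u <- enum 'I_m].
have hinit i : teq (layout [:: ztape [::] (encode D); ztape [::] [::];
   ztape [::] [::]; ztape [::] [::]; ztape [::] [::]; ztape [::] [::];
   ztape [::] [::]] i) ((init (machine_of checker) (encode D)).2 i).
  rewrite /init /layout /=; case: i => [[|[|[|[|[|[|[|i]]]]]]] hi] //=;
    by apply: teq_refl.
rewrite -encodeE in hexec hs.
have [T2 _ h] := exec_teq hexec hinit.
exists s; last by rewrite [init _ _]surjective_pairing (exec_machine_of h).
apply: leq_trans hs _.
rewrite hornerM hornerC horner_exp hornerD hornerX hornerC.
move: (size _) => k; rewrite -[X in _ <= X]/(40 * (k + 3) ^ 10) leq_mul2l.
by rewrite !expnS expn0 muln1 -!mulnA leqnn orbT.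
Qed.
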